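(* Let $T$ be an ergodic measure preserving map on the nonatomic probability space $(X,\mathcal{A},\mu)$, let $(A_l)$ be an asymptotically rare sequence in $\mathcal{A}$, let $(\mathfrak{F},d_{\mathfrak{F}})$ be a compact metric space, and let $\widetilde\Psi$ be any $\mathfrak{F}$-valued stationary sequence. Then there is a sequence $(\psi_{A_l})$ of local observables $\psi_{A_l}:A_l\to\mathfrak{F}$ such that $\widetilde\Psi_{A_l}\overset{\mu_{A_l}}{\Longrightarrow}\widetilde\Psi$ as $l\to\infty$.
   Context: For $A\in\mathcal{A}$ with $\mu(A)>0$: $\varphi_A(x):=\inf\{n\ge1:T^nx\in A\}$, $T_Ax:=T^{\varphi_A(x)}x$, $\mu_A:=\mu(A\cap\cdot)/\mu(A)$. Asymptotically rare: $0<\mu(A_l)\to0$. A local observable on $A$ is a measurable map $\psi_A:A\to\mathfrak{F}$, and $\widetilde\Psi_A:=(\psi_A,\psi_A\circ T_A,\psi_A\circ T_A^2,\ldots):A\to\mathfrak{F}^{\mathbb{N}_0}$ (product topology). $\widetilde\Psi_{A_l}\overset{\mu_{A_l}}{\Longrightarrow}\widetilde\Psi$ means the law of $\widetilde\Psi_{A_l}$ under $\mu_{A_l}$ converges weakly to the law of $\widetilde\Psi$. *)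

(* Defs.v *)
From HB Require Import structures.
From mathcomp Require Import all_boot all_order all_algebra.
From mathcomp Require Import all_classical all_reals all_analysis.
Set Implicit Arguments. Unset Strict Implicit. Unset Printing Implicit Defensive.
Import Order.TTheory GRing.Theory Num.Theory.
Import numFieldNormedType.Exports.
Local Open Scope classical_set_scope.
Local Open Scope ring_scope.

Definition borel_set (F : topologicalType) : set (set F) := <<s @open F >>.

(* Borel measurability of f : D -> F (D a measurable subset of X); this is the
   unfolding of measurable_fun for the Borel sigma-algebra on F *)
Definition borel_measurable_fun {d} {X : measurableType d} {F : topologicalType}
  (D : set X) (f : X -> F) :=
  measurable D /\ forall B, borel_set B -> measurable (D `&` f @^-1` B).

(* first return time phi_A and first return map T_A.  On the (null) set of
   points of A that never return, we set T_A x := x. *)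
Definition returns {X : Type} (T : X -> X) (A : set X) (x : X) : pred nat :=
  fun n => (0 < n)%N && `[< A (iter n T x) >].

Definition first_return_map {X : Type} (T : X -> X) (A : set X) (x : X) : X :=
  match pselect (exists n, returns T A x n) with
  | left h => iter (ex_minn h) T x
  | right _ => x
  end.

Definition Psi_proc {X F : Type} (T : X -> X) (A : set X) (psi : X -> F) (x : X) : nat -> F :=
  fun n => psi (iter n (first_return_map T A) x).

Section defs.
Context {d : measure_display} {X : measurableType d} {R : realType}.

Definition measure_preserving (mu : {measure set X -> \bar R}) (T : X -> X) :=
  measurable_fun setT T /\ forall B, measurable B -> mu (T @^-1` B) = mu B.

Definition ergodic (mu : {measure set X -> \bar R}) (T : X -> X) :=
  forall B, measurable B -> T @^-1` B = B -> mu B = 0%E \/ mu B = 1%E.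

Definition nonatomic (mu : {measure set X -> \bar R}) :=
  forall B, measurable B -> (0 < mu B)%E ->
    exists C, [/\ measurable C, C `<=` B & (0 < mu C < mu B)%E].

Definition asymptotically_rare (mu : {measure set X -> \bar R}) (A : nat -> set X) :=
  (forall l, measurable (A l) /\ (0 < mu (A l))%E) /\ (mu \o A) @ \oo --> 0%E.
End defs.

Definition stationary {d} {Om : measurableType d} {R : realType}
  {F : topologicalType} (P : probability Om R) (Y : nat -> Om -> F) :=
  (forall n, borel_measurable_fun setT (Y n)) /\
  forall (k : nat) (B : nat -> set F), (forall i, borel_set (B i)) ->
    P [set w | forall i, (i < k)%N -> B i (Y i w)] =
    P [set w | forall i, (i < k)%N -> B i (Y i.+1 w)].

(* Main.v *)
Require Import Defs.
From HB Require Import structures.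
From mathcomp Require Import all_boot all_order all_algebra.
From mathcomp Require Import all_classical all_reals all_analysis.
From mathcomp Require Import ring lra.
Set Implicit Arguments.
Unset Strict Implicit.
Import Order.TTheory GRing.Theory Num.Theory.
Import numFieldNormedType.Exports.
Local Open Scope classical_set_scope.
Local Open Scope ring_scope.

(** Quantize [F] by a finite measurable net, so that the target becomes a
stationary process with finitely many letters; only the laws of its words of
length [k] have to be matched, up to a small error.

By ergodicity the first return map [S] preserves [mu] restricted to [A], and
almost every orbit of [S] visits any prescribed set [C] of positive measure.
Take [C] tiny and cut every orbit, backwards from its next visit to [C], into
blocks of length [n >> k]. On the set of block ends, nonatomicity allows to
choose a label in the set of words of length [n] distributed like the target
word, and the observable reads this word along the block. A window of length
[k] lies inside a single block except for a proportion [k / n] of the time, and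
inside a block stationarity makes every position of the window equally good.

Lower bounds for the probabilities of all words suffice, since the weights of
both laws have the same sum. *)

(** * Finite nonatomic measures *)

Section finite_measure_real.
Context {d : measure_display} {X : measurableType d} {R : realType}.
Variable nu : {finite_measure set X -> \bar R}.
Implicit Types A B C D E : set X.

Lemma fineK_measure B : measurable B -> ((fine (nu B))%:E = nu B)%E.
Proof. by move=> mB; rewrite fineK// fin_num_measure. Qed.

Lemma fine_measure_ge0 B : 0 <= fine (nu B).
Proof. by rewrite fine_ge0. Qed.

Lemma fine_measure0 : fine (nu set0) = 0.
Proof. by rewrite measure0. Qed.

Lemma fine_le_measure A B : measurable A -> measurable B -> A `<=` B ->
  fine (nu A) <= fine (nu B).
Proof.
move=> mA mB AB; rewrite fine_le ?fin_num_measure//.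
by apply: le_measure => //; rewrite inE.
Qed.

Lemma fine_measureU A B : measurable A -> measurable B -> A `&` B = set0 ->
  fine (nu (A `|` B)) = fine (nu A) + fine (nu B).
Proof. by move=> mA mB AB; rewrite measureU// fineD// fin_num_measure. Qed.

Lemma fine_measureU2 A B : measurable A -> measurable B ->
  fine (nu (A `|` B)) <= fine (nu A) + fine (nu B).
Proof.
move=> mA mB; rewrite -fineD ?fin_num_measure// fine_le ?fin_numD ?fin_num_measure//.
- exact: measurableU.
- exact: measureU2.
Qed.

Lemma fine_measureD A B : measurable A -> measurable B ->
  fine (nu (A `\` B)) = fine (nu A) - fine (nu (A `&` B)).
Proof.
move=> mA mB; rewrite measureD//; last by rewrite ltey_eq fin_num_measure.
by rewrite fineB// fin_num_measure//; exact: measurableI.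
Qed.

Lemma fine_measureD_ge A B : measurable A -> measurable B ->
  fine (nu A) - fine (nu B) <= fine (nu (A `\` B)).
Proof.
move=> mA mB; rewrite fine_measureD// lerD2l lerN2 fine_le_measure//.
exact: measurableI.
Qed.

Lemma fine_measure_bigsetU (I : choiceType) (s : seq I) (Q : pred I)
    (B : I -> set X) :
  uniq s -> (forall i, measurable (B i)) -> trivIset setT B ->
  fine (nu (\big[setU/set0]_(i <- s | Q i) B i)) =
  \sum_(i <- s | Q i) fine (nu (B i)).
Proof.
move=> + mB tB; elim: s => [|i s IH] /=; first by rewrite !big_nil fine_measure0.
case/andP=> si us; rewrite !big_cons; case: ifP => Qi; last exact: IH.
rewrite fine_measureU// ?IH//; first by apply: bigsetU_measurable.
rewrite -bigcup_seq_cond; apply/seteqP; split=> // x [Bi [j /= /andP[js Qj] Bj]].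
have ij : i = j by apply: (tB i j) => //; exists x.
by move: si; rewrite ij js.
Qed.

Lemma fine_measure_bigsetU_le (I : Type) (s : seq I) (Q : pred I)
    (B : I -> set X) : (forall i, measurable (B i)) ->
  fine (nu (\big[setU/set0]_(i <- s | Q i) B i)) <=
  \sum_(i <- s | Q i) fine (nu (B i)).
Proof.
move=> mB; elim: s => [|i s IH]; first by rewrite !big_nil fine_measure0.
rewrite !big_cons; case: ifP => Qi //.
apply: le_trans (fine_measureU2 _ _) _ => //; first by apply: bigsetU_measurable.
by rewrite lerD2l.
Qed.

Lemma measurable_finite_valued (U : finType) (W : X -> U) (Q : set U) :
  (forall u, measurable (W @^-1` [set u])) -> measurable (W @^-1` Q).
Proof.
move=> mW; have -> : W @^-1` Q = \bigcup_(u in Q) W @^-1` [set u].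
  by apply/seteqP; split=> [x Qx|x [u Qu /= ->]]; [exists (W x)|].
by apply: fin_bigcup_measurable => //; exact: finite_finset.
Qed.

Lemma fine_measure_finite_valued (U : finType) (W : X -> U) (Q : pred U) D :
  measurable D -> (forall u, measurable (W @^-1` [set u])) ->
  fine (nu (D `&` [set x | Q (W x)])) =
  \sum_(u | Q u) fine (nu (D `&` W @^-1` [set u])).
Proof.
move=> mD mW; rewrite -fine_measure_bigsetU//.
- congr (fine (nu _)); rewrite -bigcup_seq_cond; apply/seteqP; split.
    move=> x [Dx Qx]; exists (W x) => //=.
    by rewrite mem_index_enum Qx.
  by move=> x [u /= /andP[_ Qu] [Dx ->]].
- exact: index_enum_uniq.
- by move=> u; exact: measurableI.
- by move=> i j _ _ [x [[_ /= <-] [_ /= <-]]].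
Qed.

(** A proper piece of [D] and its complement in [D] both have positive mass, and the lighter of the
    two has at most half. *)
Lemma nonatomic_half D : nonatomic nu -> measurable D -> 0 < fine (nu D) ->
  exists C, [/\ measurable C, C `<=` D, 0 < fine (nu C) &
                fine (nu C) <= fine (nu D) / 2].
Proof.
move=> na mD D0.
have D0' : (0 < nu D)%E by rewrite -fineK_measure.
have [C [mC CD CltD]] := na _ mD D0'.
have {CltD} : (0 < nu C < nu D)%E := CltD.
rewrite -(fineK_measure mC) -(fineK_measure mD) !lte_fin => /andP[C0 CltD].
have [le|gt] := lerP (fine (nu C)) (fine (nu D) / 2); first by exists C.
have e : fine (nu (D `\` C)) = fine (nu D) - fine (nu C).
  by rewrite fine_measureD// setIidr.
exists (D `\` C); split; first exact: measurableD.
- by move=> x [].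
- by rewrite e; lra.
- by rewrite e; lra.
Qed.

Lemma nonatomic_small D (e : R) : nonatomic nu -> measurable D ->
  0 < fine (nu D) -> 0 < e ->
  exists C, [/\ measurable C, C `<=` D, 0 < fine (nu C) & fine (nu C) < e].
Proof.
move=> na mD D0 e0.
(* Repeated halving; the weaker bound with [n.+1] survives each step because [n.+2 <= 2 * n.+1], and
   the Archimedean property then suffices. *)
have H n : exists C, [/\ measurable C, C `<=` D, 0 < fine (nu C) &
                fine (nu C) * n.+1%:R <= fine (nu D)].
  elim: n => [|n [C [mC CD C0 Cn]]]; first by exists D; split=> //; rewrite mulr1.
  have [C' [mC' C'C C'0 C'h]] := nonatomic_half na mC C0.
  exists C'; split=> //; first exact: subset_trans C'C CD.
  apply: le_trans Cn; rewrite -[n.+2]addn1 natrD.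
  have : (1 : R) <= n.+1%:R by rewrite ler1n.
  by move: (n.+1%:R : R) => a a1; nra.
have [n ne] : exists n : nat, fine (nu D) / e < n.+1%:R.
  exists (Num.truncn (fine (nu D) / e)); exact: Num.Theory.truncnS_gt.
have [C [mC CD C0 Cn]] := H n; exists C; split=> //.
rewrite ltr_pdivrMr// in ne.
have n0 : (0 : R) < n.+1%:R by rewrite ltr0n.
rewrite -(ltr_pM2r n0); apply: le_lt_trans Cn _; by rewrite mulrC.
Qed.

(* Greedy exhaustion: each step gains at least half of what can still be
   gained, so a strict gap below [t] would force unbounded growth. *)
Lemma nonatomic_intermediate D (t : R) : nonatomic nu -> measurable D ->
  0 <= t <= fine (nu D) ->
  exists E, [/\ measurable E, E `<=` D & fine (nu E) = t].
Proof.
move=> na mD /andP[t0 tD].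
pose adm E := [/\ measurable E, E `<=` D & fine (nu E) <= t].
have step E : exists E', adm E -> [/\ adm E', E `<=` E' &
   forall E'', adm E'' -> E `<=` E'' ->
     fine (nu E'') - fine (nu E) <= 2 * (fine (nu E') - fine (nu E))].
  have [aE|] := pselect (adm E); last by exists set0.
  (* The masses reachable by admissible supersets of [E]; a superset within half of the gap to the
     supremum is the greedy choice. *)
  pose V : set R := [set fine (nu E') | E' in [set E' | adm E' /\ E `<=` E']].
  have VE : V (fine (nu E)) by exists E; split.
  have supV : has_sup V.
    by split; [exists (fine (nu E))|exists t => _ [E' [[_ _ ?] _] <-]].
  have ubV E' : adm E' -> E `<=` E' -> fine (nu E') <= sup V.
    by move=> aE' EE'; apply: ub_le_sup; [case: supV|exists E'; split].
  have := ubV _ aE (@subset_refl _ _); rewrite le_eqVlt => /orP[/eqP sE|sE].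
    exists E => _; split=> // E'' aE'' EE''.
    by have := ubV _ aE'' EE''; rewrite -sE; lra.
  have e0 : 0 < (sup V - fine (nu E)) / 2 by lra.
  have [_ [E' [aE' EE'] <-] lt] := sup_adherent e0 supV.
  exists E' => _; split=> // E'' aE'' EE''.
  by have := ubV _ aE'' EE''; lra.
have [next nextP] := choice step.
pose E n := iter n next set0.
have aE n : adm (E n).
  elim: n => [|n IH] /=; last by have [] := nextP _ IH.
  by split=> //; rewrite fine_measure0.
have mE n : measurable (E n) by case: (aE n).
have ndE n : E n `<=` E n.+1 by have [] := nextP _ (aE n).
pose Eoo := \bigcup_n E n.
have mEoo : measurable Eoo by exact: bigcupT_measurable.
have EooD : Eoo `<=` D by move=> x [n _]; case: (aE n) => _ + _; apply.
have cvgE : (nu \o E) x @[x --> \oo] --> nu Eoo.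
  apply: nondecreasing_cvg_mu => //; apply/nondecreasing_seqP => n.
  by rewrite subsetEset.
have EooT : fine (nu Eoo) <= t.
  rewrite -lee_fin fineK_measure//; apply: (cvge_le _ cvgE).
  by apply: nearW => n /=; rewrite -fineK_measure// lee_fin; case: (aE n).
have [eq|lt] := eqVneq (fine (nu Eoo)) t; first by exists Eoo.
have {}lt : fine (nu Eoo) < t by rewrite lt_neqAle lt.
have mDE : measurable (D `\` Eoo) by exact: measurableD.
(* If the limit falls short of [t], adding a small [C] to it stays admissible, so at every stage at
   least [nu C] could still be gained. *)
have [||C [mC CD C0 Ct]] := @nonatomic_small (D `\` Eoo) (t - fine (nu Eoo)) na mDE.
- by rewrite fine_measureD// setIidr// subr_gt0; lra.
- by rewrite subr_gt0.
have mC' : measurable (Eoo `|` C) by exact: measurableU.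
have mEC : fine (nu (Eoo `|` C)) = fine (nu Eoo) + fine (nu C).
  apply: fine_measureU => //; apply/seteqP; split=> // x [Ex /CD[_]]; exact.
have aC : adm (Eoo `|` C).
  split=> //; last by rewrite mEC; lra.
  by move=> x [/EooD//|/CD[]].
have gain n : fine (nu C) / 2 * n%:R <= fine (nu (E n)).
  elim: n => [|n IH]; first by rewrite mulr0 fine_measure0.
  have [_ _ /(_ _ aC)] := nextP _ (aE n).
  have EnEoo : E n `<=` Eoo by move=> x Ex; exists n.
  have -> : next (E n) = E n.+1 by [].
  move=> /(_ (subset_trans EnEoo (@subsetUl _ _ _))).
  have := fine_le_measure (mE n) mEoo EnEoo.
  by rewrite mEC -(natr1 n) [_ * (n%:R + 1)]mulrDr mulr1; lra.
have := Num.Theory.truncnS_gt (t / (fine (nu C) / 2)).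
set N := (Num.truncn _).+1; rewrite ltr_pdivrMr; last by lra.
have := gain N; have [_ _] := aE N; rewrite mulrC; lra.
Qed.

(** Pieces of mass exactly [c u] are carved off one letter at a time. Whatever is left over receives
    [u0], hence only an inequality in the conclusion. *)
Lemma nonatomic_labelling (U : finType) (u0 : U) D (c : U -> R) :
  nonatomic nu -> measurable D -> (forall u, 0 <= c u) ->
  \sum_u c u <= fine (nu D) ->
  exists w : X -> U, (forall u, measurable (w @^-1` [set u])) /\
    forall u, c u <= fine (nu (D `&` w @^-1` [set u])).
Proof.
move=> na mD c0 cD.
suff : forall (s : seq U) D, uniq s -> measurable D ->
    \sum_(u <- s) c u <= fine (nu D) ->
    exists w : X -> U, (forall u, measurable (w @^-1` [set u])) /\
    forall u, u \in s -> c u <= fine (nu (D `&` w @^-1` [set u])).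
  move=> /(_ (index_enum U) D (index_enum_uniq U) mD cD)[w [mw H]].
  by exists w; split=> // u; exact/H/mem_index_enum.
elim=> [|u s IH] {cD mD}D /=.
  move=> _ _ _; exists (fun=> u0); split=> // u.
  have [<-|ne] := pselect (u0 = u).
    by rewrite (_ : _ @^-1` _ = setT)//; apply/seteqP.
  by rewrite (_ : _ @^-1` _ = set0)//; apply/seteqP; split.
case/andP=> us uns mD; rewrite big_cons => cD.
have s0 : 0 <= \sum_(u <- s) c u by rewrite sumr_ge0.
have [|E [mE ED Ec]] := @nonatomic_intermediate D (c u) na mD.
  by rewrite c0/=; lra.
have mDE : measurable (D `\` E) by exact: measurableD.
have [|w [mw wc]] := IH (D `\` E) uns mDE.
  by rewrite fine_measureD// setIidr// Ec; lra.
exists (fun x => if x \in E then u else w x).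
have lev v : (fun x => if x \in E then u else w x) @^-1` [set v] =
    (if u == v then E else set0) `|` (w @^-1` [set v] `\` E).
  apply/seteqP; split=> x /=.
    case: ifPn => [/set_mem Ex <-|/negP xE <-]; first by rewrite eqxx; left.
    by right; split=> // Ex; apply: xE; exact/mem_set.
  case=> [|[<- nE]]; first by case: eqP => // <- Ex; rewrite mem_set.
  by rewrite memNset.
have mlev v : measurable (((fun x => if x \in E then u else w x)) @^-1` [set v]).
  rewrite lev; apply: measurableU; last exact: measurableD.
  by case: ifP.
split=> // v; rewrite inE => /orP[/eqP ->|vs].
  rewrite -Ec; apply: fine_le_measure => //; first exact: measurableI.
  by move=> x Ex; split; [exact: ED|rewrite lev eqxx; left].
apply: le_trans (wc _ vs) _; apply: fine_le_measure => //; do ?exact: measurableI.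
by move=> x [[Dx nE] wx]; split=> //; rewrite lev; right.
Qed.

End finite_measure_real.

(** * Towers over a small set *)

Lemma measure_preserving_iter {d} {X : measurableType d} {R : realType}
    (mu : {measure set X -> \bar R}) (T : X -> X) (n : nat) :
  measure_preserving mu T -> measure_preserving mu (iter n T).
Proof.
move=> [mT pT]; elim: n => [|n [mTn pTn]].
  by split=> //; exact: measurable_id.
split; first exact: (measurableT_comp mT mTn).
move=> B mB; have mTB : measurable (T @^-1` B).
  by rewrite -[X in measurable X]setTI; exact: mT.
by rewrite -(pT _ mB) -(pTn _ mTB).
Qed.

Section first_hit.
Context {X : Type}.
Variable S : X -> X.

Definition first_hit (C : set X) (m : nat) : set X :=
  [set x | C (iter m S x) /\ forall j, (j < m)%N -> ~ C (iter j S x)].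

Lemma first_hit_uniq C x m m' : first_hit C m x -> first_hit C m' x -> m = m'.
Proof.
by move=> [Cm Hm] [Cm' Hm']; case: (ltngtP m m') => // [/Hm'|/Hm].
Qed.

Lemma first_hit_iter C x m i : (i <= m)%N ->
  first_hit C m x -> first_hit C (m - i)%N (iter i S x).
Proof.
move=> im [Cm Hm]; split; first by rewrite -iterD subnK.
by move=> j jmi; rewrite -iterD; apply: Hm; rewrite addnC -ltn_subRL.
Qed.

Lemma first_hit_exists C x m : C (iter m S x) -> exists m', first_hit C m' x.
Proof.
move=> Cm; have exP : exists m, `[< C (iter m S x) >] by exists m; apply/asboolP.
exists (ex_minn exP); case: ex_minnP => m' /asboolP Cm' min.
split=> // j jm' /asboolP/min.
by rewrite leqNgt jm'.
Qed.

Definition hit_time C x := xget 0%N [set m | first_hit C m x].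

Lemma hit_timeE C m x : first_hit C m x -> hit_time C x = m.
Proof.
move=> h; rewrite /hit_time; case: xgetP => [m' _ h'|/(_ m)//].
exact: first_hit_uniq h' h.
Qed.

End first_hit.

Section return_tower.
Context {d : measure_display} {X : measurableType d} {R : realType}.
Variables (nu : {finite_measure set X -> \bar R}) (S : X -> X).
Hypothesis pS : measure_preserving nu S.

Lemma measurable_iter_preimage n B :
  measurable B -> measurable (iter n S @^-1` B).
Proof.
move=> mB; rewrite -[X in measurable X]setTI.
by case: (measure_preserving_iter n pS) => + _; apply.
Qed.

Lemma fine_iter_preimage n B :
  measurable B -> fine (nu (iter n S @^-1` B)) = fine (nu B).
Proof.
move=> mB; congr fine.
by case: (measure_preserving_iter n pS) => _; exact.
Qed.

Lemma measurable_first_hit C m : measurable C -> measurable (first_hit S C m).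
Proof.
move=> mC; rewrite (_ : first_hit S C m = iter m S @^-1` C `&`
    \bigcap_(j in `I_m) (~` (iter j S @^-1` C))).
  apply: measurableI; first exact: measurable_iter_preimage.
  apply: fin_bigcap_measurable => // j _.
  by apply: measurableC; exact: measurable_iter_preimage.
by apply/seteqP; split=> x [Cx H]; split=> // j /H.
Qed.

Lemma measurable_hit_time C m :
  measurable C -> measurable (hit_time S C @^-1` [set m]).
Proof.
move=> mC; have mH j := measurable_first_hit j mC.
(* The default value of [hit_time] puts the points that never reach [C] into the level set of 0. *)
have -> : hit_time S C @^-1` [set m] = first_hit S C m `|`
    (if m == 0%N then ~` (\bigcup_j first_hit S C j) else set0).
  apply/seteqP; split=> x /=.
    rewrite /hit_time; case: xgetP => [m' _ h' <-|no <-]; first by left.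
    by right=> /= -[j _ hj]; exact: (no j).
  case=> [h|]; first exact: (hit_timeE h).
  case: eqP => // -> nh.
  by rewrite /hit_time; case: xgetP => // m' _ h'; case: nh; exists m'.
apply: measurableU => //; case: ifP => // _.
by apply: measurableC; exact: bigcupT_measurable.
Qed.

(* [i] is the number of steps left until the end of the current block. *)
Definition tower_level C n i : set X :=
  \bigcup_j first_hit S C (j * n.+1 + i)%N.

Lemma measurable_tower_level C n i :
  measurable C -> measurable (tower_level C n i).
Proof.
by move=> mC; apply: bigcupT_measurable => j; exact: measurable_first_hit.
Qed.

(** Almost every point reaches [C] and so lies in one of the [n.+1] levels. Level [i] is mapped into
    the base by [i] steps of the measure preserving [S], so it is no heavier than the base. *)
Lemma tower_base_large C n : measurable C ->
  nu [set x | forall m, ~ C (iter m S x)] = 0%E ->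
  fine (nu setT) <= n.+1%:R * fine (nu (tower_level C n 0)).
Proof.
move=> mC null; have mH j := measurable_first_hit j mC.
set N := [set x | _] in null.
have mN : measurable N.
  rewrite (_ : N = ~` (\bigcup_m (iter m S @^-1` C))).
    apply/measurableC/bigcupT_measurable => m; exact: measurable_iter_preimage.
  apply/seteqP; split=> x; first by move=> Nx [m _]; exact: Nx.
  by move=> nC m Cm; apply: nC; exists m.
pose V := \big[setU/set0]_(i < n.+1) tower_level C n i.
have mV : measurable V.
  by apply: bigsetU_measurable => i _; exact: measurable_tower_level.
apply: (@le_trans _ _ (fine (nu (N `|` V)))).
  apply: fine_le_measure => //; first exact: measurableU.
  move=> x _; have [Nx|] := pselect (N x); first by left.
  move=> /existsNP[m /contrapT Cm]; have [m' hm'] := first_hit_exists Cm; right.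
  rewrite /V -bigcup_seq.
  (* The level of a point is its hitting time modulo the block length. *)
  exists (inord (m' %% n.+1)) => /=; first by rewrite mem_index_enum.
  exists (m' %/ n.+1)%N => //.
  by rewrite inordK ?ltn_pmod// -divn_eq.
apply: (le_trans (fine_measureU2 nu mN mV)).
rewrite [nu N]null add0r.
apply: (le_trans (fine_measure_bigsetU_le _ _ _ _)).
  by move=> i; exact: measurable_tower_level.
rewrite mulr_natl -[X in _ *+ X]card_ord -sumr_const.
apply: ler_sum => i _.
rewrite -(@fine_iter_preimage i (tower_level C n 0)); last exact: measurable_tower_level.
apply: fine_le_measure.
- exact: measurable_tower_level.
- exact/measurable_iter_preimage/measurable_tower_level.
- move=> x [j _ hj]; exists j => //=.
  rewrite addn0 -[X in first_hit S C X](addnK i).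
  by apply: first_hit_iter => //; exact: leq_addl.
Qed.

Variables (I : finType) (k n : nat) (C : set X).
Variable w : X -> {ffun 'I_n.+1 -> I}.
Hypothesis mC : measurable C.
Hypothesis mw : forall u, measurable (w @^-1` [set u]).

(* The word attached to the base point of the tower above [x] is read in
   forward time: the base carries its last letter. *)
Definition tower_label x : I :=
  let i := (hit_time S C x %% n.+1)%N in w (iter i S x) (inord (n - i)).

Lemma measurable_tower_label a : measurable (tower_label @^-1` [set a]).
Proof.
rewrite (_ : _ @^-1` _ = \bigcup_m (hit_time S C @^-1` [set m] `&`
    (iter (m %% n.+1) S @^-1`
      (w @^-1` [set u | u (inord (n - m %% n.+1)) = a])))).
  apply: bigcupT_measurable => m; apply: measurableI.
    exact: measurable_hit_time.
  apply: measurable_iter_preimage; exact: measurable_finite_valued.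
apply/seteqP; split=> x; first by move=> ax; exists (hit_time S C x).
by move=> [m _ [/= <-]].
Qed.

(** Moving [t] steps up to the end of the block keeps the base point [iter i S x] and advances the
    position read by [t]. *)
Lemma tower_label_iter i x j t : first_hit S C (j * n.+1 + i)%N x ->
  (i <= n)%N -> (t <= i)%N ->
  tower_label (iter t S x) = w (iter i S x) (inord (n - i + t)).
Proof.
move=> hx ile ti.
have := first_hit_iter (leq_trans ti (leq_addl (j * n.+1) i)) hx.
rewrite -addnBA// => hit; have ht := hit_timeE hit.
have itn : (i - t < n.+1)%N by rewrite ltnS (leq_trans (leq_subr _ _)).
rewrite /tower_label ht modnMDl modn_small// -iterD subnK//.
by rewrite subnA.
Qed.

Definition subword (s : nat) (v : {ffun 'I_k -> I}) (u : {ffun 'I_n.+1 -> I}) :=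
  [forall t : 'I_k, u (inord (s + t)) == v t].

Definition label_cylinder (psi : X -> I) (v : {ffun 'I_k -> I}) : set X :=
  [set x | forall t : 'I_k, psi (iter t S x) = v t].

Lemma measurable_label_cylinder psi v :
  (forall a, measurable (psi @^-1` [set a])) -> measurable (label_cylinder psi v).
Proof.
move=> mpsi; rewrite (_ : label_cylinder psi v =
    \bigcap_(t in [set: 'I_k]) (iter t S @^-1` (psi @^-1` [set v t]))).
  apply: fin_bigcap_measurable => // t _; exact: measurable_iter_preimage.
by apply/seteqP; split=> x H t; [move=> _|]; exact: H.
Qed.

(** With at least [k - 1] steps left in the block, the whole window reads consecutive letters of one
    word, starting at position [n - i]. *)
Lemma tower_slice_sub i v : (i <= n)%N -> (k <= i.+1)%N ->
  tower_level C n i `&` iter i S @^-1` [set x | subword (n - i) v (w x)]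
  `<=` label_cylinder tower_label v.
Proof.
move=> ile ki x [[j _ hx] /forallP/= sw] t.
have ti : (t <= i)%N by rewrite -ltnS (leq_trans (ltn_ord t)).
by rewrite (tower_label_iter hx)//; apply/eqP.
Qed.

(** A point sent into the base by [i] steps lies in level [i] unless it meets [C] during these
    steps. That exceptional set has mass at most [i] times that of [C]. *)
Lemma tower_slice_large i v :
  fine (nu (tower_level C n 0 `&` [set x | subword (n - i) v (w x)]))
    - i%:R * fine (nu C)
  <= fine (nu (tower_level C n i `&`
       iter i S @^-1` [set x | subword (n - i) v (w x)])).
Proof.
have mQ : measurable [set x | subword (n - i) v (w x)].
  exact: (@measurable_finite_valued _ _ _ w [set u | subword (n - i) v u]).
set Q := [set x | _] in mQ *.
have mQ0 : measurable (tower_level C n 0 `&` Q).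
  by apply: measurableI => //; exact: measurable_tower_level.
pose bad := \big[setU/set0]_(j < i) (iter j S @^-1` C).
have mbad : measurable bad.
  by apply: bigsetU_measurable => j _; exact: measurable_iter_preimage.
have badC : fine (nu bad) <= i%:R * fine (nu C).
  apply: (le_trans (fine_measure_bigsetU_le _ _ _ _)).
    by move=> j; exact: measurable_iter_preimage.
  rewrite mulr_natl -[X in _ *+ X]card_ord -sumr_const.
  by apply: ler_sum => j _; rewrite fine_iter_preimage.
rewrite -(fine_iter_preimage i mQ0).
have mP : measurable (iter i S @^-1` (tower_level C n 0 `&` Q)).
  exact: measurable_iter_preimage.
apply: (@le_trans _ _ (fine (nu (iter i S @^-1` (tower_level C n 0 `&` Q) `\` bad)))).
  by apply: le_trans (fine_measureD_ge nu mP mbad); rewrite lerD2l lerN2.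
apply: fine_le_measure; first exact: measurableD.
  apply: measurableI; first exact: measurable_tower_level.
  exact: measurable_iter_preimage.
move=> x [[[j _ hj] Qx] nbad]; split=> //; exists j => //.
move: hj; rewrite addn0 => -[Cj Hj].
split; first by rewrite iterD.
move=> t tj; have [ti|it] := ltnP t i.
  move=> Ct; apply: nbad; rewrite /bad -bigcup_seq.
  by exists (Ordinal ti) => //=; rewrite mem_index_enum.
by rewrite -(subnK it) iterD; apply: Hj; rewrite ltn_subLR// addnC.
Qed.

(** The slices of the levels [k <= i <= n] are disjoint parts of the cylinder. Each has mass at
    least [q] minus the error of [tower_slice_large], and the errors add up to at most [n.+1 * n.+1]
    times the mass of [C]. *)
Lemma tower_cylinder_large (v : {ffun 'I_k -> I}) (q : R) :
  (forall s, (s + k <= n.+1)%N -> q <=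
    fine (nu (tower_level C n 0 `&` [set x | subword s v (w x)]))) ->
  (n.+1 - k)%:R * q - (n.+1 * n.+1)%:R * fine (nu C) <=
  fine (nu (label_cylinder tower_label v)).
Proof.
move=> hq.
pose Q (i : 'I_n.+1) := tower_level C n i `&`
       iter i S @^-1` [set x | subword (n - i) v (w x)].
have mQ i : measurable (Q i).
  apply: measurableI; first exact: measurable_tower_level.
  apply: measurable_iter_preimage.
  exact: (@measurable_finite_valued _ _ _ w [set u | subword (n - i) v u]).
have tQ : trivIset setT Q.
  (* The hitting time is unique, and its remainder modulo [n.+1] is the level. *)
  move=> i j _ _ [x [[[a _ ha] _] [[b _ hb] _]]]; apply/val_inj => /=.
  have := congr1 (modn^~ n.+1) (first_hit_uniq ha hb).
  by rewrite !modnMDl !modn_small.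
have sQ : \big[setU/set0]_(i < n.+1 | (k <= i)%N) Q i `<=`
    label_cylinder tower_label v.
  rewrite -bigcup_seq_cond => x [i /= /andP[_ ki]] Qx.
  apply: (@tower_slice_sub i v) => //; first by rewrite -ltnS.
  exact: leq_trans ki _.
apply: le_trans (fine_le_measure nu _ _ sQ); first last.
- exact/measurable_label_cylinder/measurable_tower_label.
- exact: bigsetU_measurable.
rewrite fine_measure_bigsetU//; last exact: index_enum_uniq.
apply: (@le_trans _ _ (\sum_(i < n.+1 | (k <= i)%N) (q - n.+1%:R * fine (nu C)))).
  rewrite sumr_const; set N := #|_|.
  have -> : N = (n.+1 - k)%N.
    rewrite /N -sum1_card (eq_bigl (fun i : 'I_n.+1 => xpredT (val i) && (k <= i)%N)).
      rewrite -(big_mkord (fun i => xpredT i && (k <= i)%N) (fun=> 1%N)).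
      by rewrite -(@big_nat_widenl _ _ _ k 0 n.+1 xpredT)// sum_nat_const_nat muln1.
    by [].
  rewrite -[(q - _) *+ _]mulr_natl mulrBr lerD2l lerN2 mulrA ler_wpM2r ?fine_measure_ge0//.
  by rewrite -natrM ler_nat leq_mul// leq_subr.
apply: ler_sum => i ki; apply: le_trans (tower_slice_large i v).
apply: lerB; first apply: hq.
  by rewrite (leq_trans (leq_add (leqnn _) ki))// subnK// -ltnS.
by rewrite ler_wpM2r ?fine_measure_ge0// ler_nat ltnW.
Qed.

End return_tower.

(** * Matching the words of a stationary process *)

Section cylinder.
Context {d : measure_display} {Om : measurableType d} {R : realType}.
Variables (P : probability Om R) (I : finType) (Z : nat -> Om -> I).
Hypothesis mZ : forall n a, measurable (Z n @^-1` [set a]).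

Definition cylinder s k (v : {ffun 'I_k -> I}) : set Om :=
  [set w | forall t : 'I_k, Z (s + t) w = v t].

Lemma measurable_cylinder s k (v : {ffun 'I_k -> I}) :
  measurable (cylinder s v).
Proof.
rewrite (_ : cylinder s v =
    \bigcap_(t in [set: 'I_k]) (Z (s + t) @^-1` [set v t])).
  by apply: fin_bigcap_measurable.
by apply/seteqP; split=> x H t; [move=> _|]; exact: H.
Qed.

Definition word k (w : Om) : {ffun 'I_k -> I} := [ffun t : 'I_k => Z t w].

Lemma preimage_word k (v : {ffun 'I_k -> I}) :
  @word k @^-1` [set v] = cylinder 0 v.
Proof.
apply/seteqP; split=> w /=; first by move=> <- t; rewrite ffunE.
by move=> H; apply/ffunP => t; rewrite ffunE; exact: H.
Qed.

Lemma measurable_word k (v : {ffun 'I_k -> I}) :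
  measurable (@word k @^-1` [set v]).
Proof. by rewrite preimage_word; exact: measurable_cylinder. Qed.

Lemma sum_cylinder k :
  \sum_(v : {ffun 'I_k -> I}) fine (P (cylinder 0 v)) = 1.
Proof.
under eq_bigr do rewrite -preimage_word -[_ @^-1` _]setTI.
rewrite -(@fine_measure_finite_valued _ _ _ P _ _ xpredT)//; last exact: measurable_word.
transitivity (fine (P setT)); last by rewrite probability_setT.
by congr (fine (P _)); apply/seteqP; split.
Qed.

Lemma sum_cylinder_subword n k s (v : {ffun 'I_k -> I}) : (s + k <= n.+1)%N ->
  \sum_(u : {ffun 'I_n.+1 -> I} | subword s v u) fine (P (cylinder 0 u)) =
  fine (P (cylinder s v)).
Proof.
move=> sk.
under eq_bigr do rewrite -preimage_word -[_ @^-1` _]setTI.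
rewrite -fine_measure_finite_valued ?setTI//; last exact: measurable_word.
congr (fine (P _)).
have lt (t : 'I_k) : (s + t < n.+1)%N.
  by apply: leq_trans sk; rewrite -addnS leq_add2l.
apply/seteqP; split=> w.
  by move=> /forallP H t; have /eqP := H t; rewrite ffunE inordK.
by move=> H; apply/forallP => t; rewrite ffunE inordK// H.
Qed.

End cylinder.

Section process_approximation.
Context {d d' : measure_display} {X : measurableType d} {Om : measurableType d'}
  {R : realType}.
Variables (nu : {finite_measure set X -> \bar R}) (S : X -> X).
Variables (P : probability Om R) (I : finType) (Z : nat -> Om -> I).
Hypothesis mZ : forall n a, measurable (Z n @^-1` [set a]).
Hypothesis statZ : forall s k (v : {ffun 'I_k -> I}),
  P (cylinder Z s v) = P (cylinder Z 0 v).
Hypothesis pS : measure_preserving nu S.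
Hypothesis na : nonatomic nu.
Hypothesis hitS : forall e : R, 0 < e -> exists C, [/\ measurable C,
  fine (nu C) < e & nu [set x | forall m, ~ C (iter m S x)] = 0%E].

(** The error [e] is split in two halves: one for windows crossing a block boundary, one for orbits
    meeting [C] inside a block. *)
Lemma process_approximation k (e : R) : 0 < e ->
  exists psi : X -> I, (forall a, measurable (psi @^-1` [set a])) /\
    forall v : {ffun 'I_k -> I},
      fine (nu setT) * fine (P (cylinder Z 0 v)) - e <=
      fine (nu (label_cylinder S psi v)).
Proof.
(* The block length [n.+1] exceeds [2 * k * a / e], so that windows crossing a boundary cost less
   than [e / 2]. *)
move=> e0; set a := fine (nu setT).
have a0 : 0 <= a by exact: fine_measure_ge0.
pose n := Num.truncn (2 * k%:R * a / e).
have n0 : 0 < n.+1%:R :> R by rewrite ltr0n.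
have ne : k%:R * a < e / 2 * n.+1%:R.
  have := Num.Theory.truncnS_gt (2 * k%:R * a / e); rewrite -/n ltr_pdivrMr//.
  by move: (n.+1%:R : R) => N; lra.
have [|C [mC Ce hitC]] := hitS (e := e / 2 / (n.+1 * n.+1)%:R).
  by rewrite divr_gt0// ?ltr0n//; lra.
pose u0 : {ffun 'I_n.+1 -> I} := [ffun t : 'I_n.+1 => Z t point].
set D := tower_level S C n 0.
have mD : measurable D by exact: (measurable_tower_level pS).
have D0 : 0 <= fine (nu D) by exact: fine_measure_ge0.
(* The base is labelled by words of length [n.+1] with the law of the target; these weights sum to
   the mass of [D]. *)
pose c (u : {ffun 'I_n.+1 -> I}) := fine (nu D) * fine (P (cylinder Z 0 u)).
have c0 u : 0 <= c u by rewrite mulr_ge0 ?fine_measure_ge0.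
have [|w [mw wc]] := nonatomic_labelling u0 na mD c0.
  by rewrite -mulr_sumr sum_cylinder// mulr1.
exists (tower_label S C w); split.
  by move=> b; apply: (measurable_tower_label pS).
move=> v; set q := fine (P (cylinder Z 0 v)).
have q0 : 0 <= q by exact: fine_measure_ge0.
have q1 : q <= 1.
  rewrite -lee_fin fineK_measure ?probability_le1//; exact: measurable_cylinder.
have := @tower_cylinder_large _ _ _ nu S pS I k n C w mC mw v (fine (nu D) * q).
rewrite -/D; set L := fine (nu (label_cylinder _ _ _)) => H.
(* The labels with [v] at position [s] carry at least [nu D] times the probability of seeing [v] at
   time [s], which by stationarity is [q] for every [s]. *)
have {}H : (n.+1 - k)%:R * (fine (nu D) * q) - (n.+1 * n.+1)%:R * fine (nu C) <= L.
  apply: H => s sk; rewrite fine_measure_finite_valued//.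
  rewrite /q -(statZ s) -(sum_cylinder_subword P mZ v sk) mulr_sumr.
  by apply: ler_sum => u _; exact: wc.
apply: le_trans H.
have NC : (n.+1 * n.+1)%:R * fine (nu C) <= e / 2.
  by rewrite mulrC -ler_pdivlMr ?ltr0n// ltW.
have := tower_base_large pS n mC hitC; rewrite -/D -/a => aD.
have rk : n.+1%:R - k%:R <= (n.+1 - k)%:R :> R.
  by rewrite lerBlDr -natrD ler_nat addnC -leq_subLR.
have r0 : 0 <= (n.+1 - k)%:R :> R by rewrite ler0n.
have k0 : 0 <= k%:R :> R by rewrite ler0n.
suff : a * q - e / 2 <= (n.+1 - k)%:R * (fine (nu D) * q) by lra.
rewrite -(ler_pM2l n0).
move: ne n0 aD rk r0 k0 D0.
move: (n.+1%:R : R) ((n.+1 - k)%:R : R) (k%:R : R) (fine (nu D)).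
move=> N r K m ne n0 aD rk r0 K0 m0.
(* The first inequality uses [K * a < e / 2 * N] and [q <= 1], the second the lower bound
   [a <= N * m] for the base. *)
apply: (@le_trans _ _ (r * (a * q))).
  have : (N - K) * (a * q) <= r * (a * q) by rewrite ler_wpM2r ?mulr_ge0.
  have : K * a * q <= K * a * 1 by rewrite ler_wpM2l ?mulr_ge0.
  by lra.
by rewrite [leRHS]mulrCA ler_wpM2l// mulrA ler_wpM2r.
Qed.

End process_approximation.

(** * The first return map *)

Lemma first_return_mapE (X : Type) (T : X -> X) (A : set X) n x :
  first_hit T A n (T x) -> first_return_map T A x = iter n T (T x).
Proof.
move=> [An Hn]; rewrite /first_return_map; case: pselect => [h|]; last first.
  by case; exists n.+1; rewrite /returns/=; apply/asboolP; rewrite -iterS iterSr.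
case: ex_minnP => -[|m] /andP[//= _ /asboolP Am] min.
have [nm|mn|->] := ltngtP n m; last by rewrite -iterS iterSr.
- have : returns T A x n.+1 by apply/andP; split=> //; apply/asboolP; rewrite iterSr.
  by move=> /min; rewrite ltnS leqNgt nm.
- by case: (Hn _ mn); rewrite -iterSr.
Qed.

Lemma first_return_map_none (X : Type) (T : X -> X) (A : set X) x :
  (forall n, ~ first_hit T A n (T x)) -> first_return_map T A x = x.
Proof.
move=> no; rewrite /first_return_map; case: pselect => // h.
have [n /andP[n0 /asboolP An]] := h.
case: n n0 An => // n _; rewrite iterSr => An.
by have [m /no] := first_hit_exists An.
Qed.

(** Since [C] lies in [A], the first return to [A] cannot skip the visit to [C]. Each return uses up
    at least one step of [T], whence the strong induction on [n]. *)
Lemma first_return_orbit (X : Type) (T : X -> X) (A C : set X) n x :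
  C `<=` A -> C (iter n T x) ->
  exists m, C (iter m (first_return_map T A) x).
Proof.
move=> CA; elim/ltn_ind: n x => -[|n] IH x; first by exists 0%N.
rewrite iterSr => Cx; have [m [Am Hm]] := first_hit_exists (CA _ Cx).
have mn : (m <= n)%N by rewrite leqNgt; apply/negP => /Hm; apply; exact: CA.
have [||j Cj] := IH (n - m)%N _ (first_return_map T A x).
- by rewrite ltnS leq_subr.
- by rewrite (first_return_mapE (conj Am Hm)) -iterD subnK.
by exists j.+1; rewrite iterSr.
Qed.

Section recurrence.
Context {d : measure_display} {X : measurableType d} {R : realType}.
Variables (mu : probability X R) (T : X -> X).
Hypotheses (pT : measure_preserving mu T) (eT : ergodic mu T).

Definition recurrent (C : set X) : set X :=
  lim_sup_set (fun n => iter n T @^-1` C).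

Lemma measurable_recurrent C : measurable C -> measurable (recurrent C).
Proof.
move=> mC; apply: bigcapT_measurable => n; apply: bigcup_measurable => j _.
exact: (measurable_iter_preimage pT).
Qed.

Lemma recurrentP C x : recurrent C x <->
  forall m, exists n, (m <= n)%N /\ C (iter n T x).
Proof.
split=> [H m|H m _]; first by have [n /= mn Cn] := H m I; exists n.
by have [n [mn Cn]] := H m; exists n.
Qed.

(** Poincaré recurrence in ergodic form: the recurrent set is strictly invariant and at least as
    heavy as [C], so it has full measure. *)
Lemma ergodic_recurrent C : measurable C -> (0 < mu C)%E ->
  mu (~` recurrent C) = 0%E.
Proof.
move=> mC C0; have mR := measurable_recurrent mC.
have inv : T @^-1` recurrent C = recurrent C.
  apply/seteqP; split=> x /recurrentP H; apply/recurrentP => m.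
    have [n [mn Cn]] := H m; exists n.+1; split; first exact: leqW.
    by rewrite iterSr.
  have [[|n] [mn Cn]] := H m.+1; first by [].
  by exists n; split=> //; rewrite -iterSr.
have mF k : measurable (iter k T @^-1` C) by exact: (measurable_iter_preimage pT).
have ge : (mu C <= mu (recurrent C))%E.
  have := @lim_sup_set_cvg _ _ _ mu _ mF; move=> cv.
  apply: (cvge_ge _ (cv _)).
    apply: nearW => n; rewrite -(proj2 (measure_preserving_iter n pT) _ mC).
    apply: le_measure; rewrite ?inE//.
      by apply: bigcup_measurable => j _.
    by move=> x Cx; exists n => /=.
  by rewrite (le_lt_trans (probability_le1 _ _)) ?ltry//; apply: bigcup_measurable.
rewrite probability_setC//.
have [R0|->] := eT mR inv; last by rewrite subee.
by move: C0; rewrite ltNge -[X in (_ <= X)%E]R0 ge.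
Qed.

End recurrence.

Section restr_probability.
Context {d : measure_display} {X : measurableType d} {R : realType}.
Variables (mu : probability X R) (A : set X) (mA : measurable A).

Lemma probability_ltey : (mu A < +oo)%E.
Proof. by rewrite (le_lt_trans (probability_le1 _ _))// ltry. Qed.

Definition restr_probability : {finite_measure set X -> \bar R} :=
  mfrestr mA probability_ltey.

Lemma restr_probabilityE B : restr_probability B = mu (B `&` A).
Proof. by []. Qed.

End restr_probability.

Section induced_map.
Context {d : measure_display} {X : measurableType d} {R : realType}.
Variables (mu : probability X R) (T : X -> X) (A : set X).
Hypotheses (pT : measure_preserving mu T) (eT : ergodic mu T).
Hypotheses (mA : measurable A) (A0 : (0 < mu A)%E).

Let S := first_return_map T A.
(** Points entering [A] for the first time at time [n], at a point of [B]; time 0 counts, so a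
    return at time [n.+1] means that [T x] is in [land B n]. *)
Let land B n : set X := first_hit T A n `&` iter n T @^-1` B.

Let mland B n : measurable B -> measurable (land B n).
Proof.
move=> mB; apply: measurableI; first exact: (measurable_first_hit pT).
exact: (measurable_iter_preimage pT).
Qed.

Let mT1 B : measurable B -> measurable (T @^-1` B).
Proof. exact: (@measurable_iter_preimage _ _ _ mu T pT 1). Qed.

(** The second piece reflects the convention that [S] fixes the points that never return. *)
Let preim_return B : S @^-1` B = (\bigcup_n T @^-1` land B n) `|`
  (~` (\bigcup_n T @^-1` first_hit T A n) `&` B).
Proof.
apply/seteqP; split=> x /=.
  have [[n hn]|/forallNP no] := pselect (exists n, first_hit T A n (T x)).
    by rewrite /S (first_return_mapE hn) => Bx; left; exists n.
  by rewrite /S (first_return_map_none no) => Bx; right; split=> // -[n _ /no].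
case=> [[n _ [hn Bn]]|[no Bx]]; first by rewrite /S (first_return_mapE hn).
by rewrite /S first_return_map_none// => n hn; apply: no; exists n.
Qed.

Lemma measurable_first_return_map : measurable_fun setT S.
Proof.
move=> _ B mB; rewrite setTI preim_return; apply: measurableU.
  by apply: bigcupT_measurable => n; exact/mT1/mland.
apply: measurableI => //; apply/measurableC/bigcupT_measurable => n.
apply/mT1; exact: (measurable_first_hit pT).
Qed.

Let mS B : measurable B -> measurable (S @^-1` B).
Proof.
by move=> mB; rewrite -[X in measurable X]setTI; exact: measurable_first_return_map.
Qed.

Let never_returns : mu (~` (\bigcup_n T @^-1` first_hit T A n)) = 0%E.
Proof.
have mR := measurable_recurrent pT mA.
have mN : measurable (~` (\bigcup_n T @^-1` first_hit T A n)).
  apply/measurableC/bigcupT_measurable => n.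
  by apply/mT1; exact: (measurable_first_hit pT).
apply/eqP; rewrite eq_le measure_ge0 andbT -(ergodic_recurrent pT eT mA A0).
apply: le_measure; rewrite ?inE//; first exact: measurableC.
(* Asking for a visit at time at least 1 rules out the trivial visit at time 0. *)
move=> x no /recurrentP/(_ 1%N)[[|n] [//= _]]; rewrite -iterS iterSr.
by move=> An; have [m hm] := first_hit_exists An; apply: no; exists m.
Qed.

(* The part of [T @^-1` land B n] outside [A] is [land B n.+1]. *)
Let land_split B n : measurable B ->
  fine (mu (land B n)) = fine (mu (A `&` T @^-1` land B n)) +
                         fine (mu (land B n.+1)).
Proof.
move=> mB; have mL := mland n mB; have mL1 := mT1 mL.
have -> : land B n.+1 = T @^-1` land B n `\` A.
  apply/seteqP; split=> x.
    move=> [[An Hn] Bn]; split; last exact: (Hn 0%N).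
    split; last by rewrite /= -iterSr.
    split; first by rewrite -iterSr.
    by move=> j jn; rewrite -iterSr; exact: Hn.
  move=> [[[An Hn] Bn] nA]; split; last first.
    by have : B (iter n.+1 T x) by rewrite iterSr.
  split; first by rewrite iterSr.
  by move=> [|j] //; rewrite iterSr; exact: Hn.
rewrite -{1}(@fine_iter_preimage _ _ _ mu T pT 1 _ mL) -fine_measureU.
- by congr (fine (mu _)); rewrite [A `&` _]setIC setUIDK.
- exact: measurableI.
- exact: measurableD.
- by apply/seteqP; split=> // x [[Ax _] [_]].
Qed.

(** Summing [land_split] over [n] telescopes from [land B 0], which is the intersection of [A] and
    [B]; the nonnegative remainder is dropped. *)
Let return_le B : measurable B ->
  (mu (A `&` S @^-1` B) <= mu (A `&` B))%E.
Proof.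
move=> mB; set N := ~` (\bigcup_n T @^-1` first_hit T A n).
have mN : measurable N.
  apply/measurableC/bigcupT_measurable => n.
  by apply/mT1; exact: (measurable_first_hit pT).
have mL n : measurable (A `&` T @^-1` land B n).
  by apply: measurableI => //; exact/mT1/mland.
have sub : A `&` S @^-1` B `<=` (\bigcup_n (A `&` T @^-1` land B n)) `|` N.
  rewrite preim_return => x [Ax [[n _ hn]|[]]]; last by right.
  by left; exists n.
apply: (@le_trans _ _ (mu ((\bigcup_n (A `&` T @^-1` land B n)) `|` N))).
  apply: le_measure; rewrite ?inE//; first by apply: measurableI => //; exact: mS.
  by apply: measurableU => //; exact: bigcupT_measurable.
apply: (@le_trans _ _ (mu (\bigcup_n (A `&` T @^-1` land B n)) + mu N)%E).
  by apply: measureU2 => //; exact: bigcupT_measurable.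
rewrite [mu N]never_returns adde0 measure_bigcup//; last first.
  move=> i j _ _ [x [[_ [hi _]] [_ [hj _]]]]; exact: first_hit_uniq hi hj.
have tele n : \sum_(0 <= i < n) fine (mu (A `&` T @^-1` land B i)) =
    fine (mu (A `&` B)) - fine (mu (land B n)).
  elim: n => [|n IH].
    rewrite big_nil (_ : land B 0 = A `&` B) ?subrr//.
    by apply/seteqP; split=> x [] => [[]|].
  by rewrite big_nat_recr//= IH (land_split n mB); lra.
apply: lime_le.
  by apply: is_cvg_nneseries.
apply: nearW => n; rewrite (eq_bigr (fun i => (fine (mu (A `&` T @^-1` land B i)))%:E)).
  rewrite (eq_bigl xpredT); last by move=> i; rewrite in_setT.
  rewrite sumEFin tele -fineK_measure; last exact: measurableI.
  by rewrite lee_fin gerBl fine_measure_ge0.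
by move=> i _; rewrite fineK_measure.
Qed.

Let nu := restr_probability mu mA.

Lemma first_return_map_preserving : measure_preserving nu S.
Proof.
split; first exact: measurable_first_return_map.
move=> B mB; change (mu (S @^-1` B `&` A) = mu (B `&` A)).
rewrite ![_ `&` A]setIC; apply/eqP; rewrite eq_le return_le//=.
have mSB := mS mB.
have mASB : measurable (A `&` S @^-1` B) by exact: measurableI.
have mAB : measurable (A `&` B) by exact: measurableI.
(* The inequality for the complement of [B] is the reverse inequality for [B], both sides being
   taken relative to the finite mass of [A]. *)
have := return_le (measurableC mB).
have -> : A `&` S @^-1` (~` B) = A `\` (A `&` S @^-1` B).
  by rewrite setDIr setDv set0U setDE.
have -> : A `&` ~` B = A `\` (A `&` B).
  by rewrite setDIr setDv set0U setDE.
rewrite -(fineK_measure mu (measurableD mA mASB)).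
rewrite -(fineK_measure mu (measurableD mA mAB)).
rewrite -(fineK_measure mu mASB) -(fineK_measure mu mAB).
rewrite !lee_fin !fine_measureD// !setIA !setIid; lra.
Qed.

Lemma first_return_map_nonatomic : nonatomic mu -> nonatomic nu.
Proof.
move=> na B mB B0.
have [|C [mC CB C0]] := na _ (measurableI _ _ mB mA); first exact: B0.
exists C; split=> //; first by move=> x /CB[].
change (0 < mu (C `&` A) < mu (B `&` A))%E; rewrite (_ : C `&` A = C)//.
by apply/seteqP; split=> [x []//|x Cx]; split=> //; case: (CB _ Cx).
Qed.

(** A small [C] inside [A] is recurrent for [T], and every visit of a [T]-orbit to [C] is also a
    visit of the [S]-orbit. *)
Lemma first_return_map_hit : nonatomic mu -> forall e : R, 0 < e ->
  exists C, [/\ measurable C, fine (nu C) < e &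
    nu [set x | forall m, ~ C (iter m S x)] = 0%E].
Proof.
move=> na e e0.
have [||C [mC CA C0 Ce]] := @nonatomic_small _ _ _ mu A e na mA.
- by rewrite -lte_fin fineK_measure.
- exact: e0.
exists C; split=> //.
  rewrite restr_probabilityE (_ : C `&` A = C)//.
  by apply/seteqP; split=> [x []//|x Cx]; split=> //; exact: CA.
have mR := measurable_recurrent pT mC.
have mN : measurable [set x | forall m, ~ C (iter m S x)].
  rewrite (_ : [set x | _] = \bigcap_m ~` (iter m S @^-1` C)).
    apply: bigcapT_measurable => m; apply: measurableC.
    exact: (measurable_iter_preimage first_return_map_preserving).
  by apply/seteqP; split=> x H m; [move=> _|]; exact: H.
have C0' : (0 < mu C)%E by rewrite -fineK_measure// lte_fin.
apply/eqP; rewrite eq_le measure_ge0 andbT -(ergodic_recurrent pT eT mC C0').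
rewrite restr_probabilityE; apply: le_measure; rewrite ?inE//.
- exact: measurableI.
- exact: measurableC.
move=> x [Nx Ax] /recurrentP/(_ 0%N)[n [_ Cn]].
by have [m] := first_return_orbit CA Cn; exact: Nx.
Qed.

End induced_map.

(** * Quantization and continuity on the sequence space *)

Section quantization.
Context {R : realType} {F : metricType R}.

Lemma borel_set_open (B : set F) : open B -> borel_set B.
Proof. by move=> oB; exact: sub_gen_smallest. Qed.

Record quantizer := Quantizer {
  q_type : finType;
  q_point : q_type -> F;
  q_label : F -> q_type }.

Definition quantizer_spec (e : R) (q : quantizer) :=
  (forall j, borel_set (@q_label q @^-1` [set j])) /\
  forall y, ball y e (q_point (q_label q y)).

(** Finitely many open balls cover [F], and a point is labelled by a ball containing it. The label
    depends only on the vector of memberships, which makes it Borel. *)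
Lemma quantizer_exists (y0 : F) (e : R) : compact [set: F] -> 0 < e ->
  exists q, quantizer_spec e q.
Proof.
move=> cF e0.
pose PF : ptopologicalType :=
  HB.pack (F : Type) (isPointed.Build F y0) (Topological.on F).
have : @compact PF setT := cF.
rewrite compact_cover => /(_ F setT (fun x : F => (ball x e)^°)).
case=> [x _||D _ cov]; first exact: open_interior.
  move=> y _; exists y => //; exact: nbhsx_ballx.
(* The extra letter [None], with centre [y0], serves as the default of the choice of a ball. *)
pose J : finType := option (seq_sub (finmap.enum_fset D)).
pose pt (j : J) : F := oapp val y0 j.
pose inball y : {ffun J -> bool} := [ffun j => `[< (ball (pt j) e)^° y >]].
pose lab y : J := odflt None [pick j | inball y j].
exists (Quantizer pt lab); split=> [j|y] /=; last first.
  apply/ball_sym; rewrite /lab; case: pickP => [j|/=].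
    by rewrite ffunE => /asboolP /interior_subset.
  have [x xD xy] := cov y I.
  by move=> /(_ (Some (SeqSub xD))); rewrite ffunE => /asboolP; case.
pose B : measurableType _ := g_sigma_algebraType (@open F : set (set PF)).
have mvec (b : {ffun J -> bool}) :
    measurable ((inball : B -> _) @^-1` [set b]).
  rewrite (_ : _ @^-1` _ = \bigcap_(j in [set: J])
      (if b j then (ball (pt j) e)^° else ~` (ball (pt j) e)^°) ).
    apply: fin_bigcap_measurable => [|i _]; first exact: finite_finset.
    have mo : measurable ((ball (pt i) e)^° : set B).
      by apply: borel_set_open; exact: open_interior.
    by case: (b i) => //; exact: measurableC.
  apply/seteqP; split=> y /=.
    move=> <- i _; rewrite ffunE.
    by case: asboolP.
  move=> H; apply/ffunP => i; rewrite ffunE; have := H i I.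
  by case: (b i) => [/asboolP//|nb]; apply/asboolP.
exact: (@measurable_finite_valued _ B _ inball
  [set b : {ffun J -> bool} | odflt None [pick j | b j] = j] mvec).
Qed.

End quantization.

Section sequence_space.
Context {R : realType} {F : metricType R}.
Variable g : {ptws nat -> F} -> R.
Hypothesis cg : continuous g.

Lemma continuous_pointwise_cvg (u : nat -> nat -> F) (z : nat -> F) :
  (forall n, u l n @[l --> \oo] --> z n) ->
  g (u l : {ptws nat -> F}) @[l --> \oo] --> g z.
Proof.
move=> uz; apply: (@cvg_comp _ _ _ (u : nat -> {ptws nat -> F}) g _ _ _ _ (cg (x := z))).
by apply/pointwise_cvgP => n; exact: uz.
Qed.

(* Otherwise pairs of sequences agreeing on longer and longer prefixes would
   cluster at a diagonal point, contradicting continuity there. *)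
Lemma continuous_prefix (e : R) : compact [set: F] -> 0 < e ->
  exists K, forall z z' : nat -> F, (forall n, (n < K)%N -> z n = z' n) ->
    `|g z - g z'| <= e.
Proof.
move=> cF e0; apply: contrapT => /forallNP H.
have {}H K : exists zz : {ptws nat -> F} * {ptws nat -> F},
    (forall n, (n < K)%N -> zz.1 n = zz.2 n) /\ e < `|g zz.1 - g zz.2|.
  have /existsNP[z /existsNP[z' /not_implyP[zz' /negP]]] := H K.
  by rewrite -ltNge => lt; exists (z, z').
have [u uP] := choice H.
have cP : compact ([set: {ptws nat -> F}] `*` [set: {ptws nat -> F}]).
  suff : compact [set: {ptws nat -> F}] by move=> c; exact: compact_setX.
  rewrite (_ : setT = [set f : {ptws nat -> F} | forall i, [set: F] (f i)]).
    exact: (@tychonoff nat (fun=> F) (fun=> setT)).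
  by apply/seteqP; split.
have [|[a b] [_ clu]] := cP (u @ \oo) _; first by exists 0%N.
have ab : a = b.
  apply/funext => n; apply: (@metric_hausdorff _ F) => U V Un Vn.
  have [||_ [[K /= nK <-] [/= UK VK]]] := clu [set u K | K in [set K | (n < K)%N]]
     [set zz | U (zz.1 n) /\ V (zz.2 n)].
  - by exists n.+1 => // K nK; exists K.
  - exists ([set y : {ptws nat -> F} | U (y n)],
            [set y : {ptws nat -> F} | V (y n)]) => //; split=> /=.
      exact: (@proj_continuous nat (fun=> F) n a U Un).
    exact: (@proj_continuous nat (fun=> F) n b V Vn).
  - by exists ((u K).1 n); split=> //; rewrite (proj1 (uP K)).
subst b.
have ne : \forall y \near a, `|g a - g y| < e / 2.
  have /cvgrPdist_lt := cg (x := a); apply; lra.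
have [||_ [[K _ <-] [/= UK VK]]] := clu [set u K | K in setT]
     [set zz | `|g a - g zz.1| < e / 2 /\ `|g a - g zz.2| < e / 2].
- by exists 0%N => // K _; exists K.
- by exists ([set y | `|g a - g y| < e / 2], [set y | `|g a - g y| < e / 2]).
have [_] := uP K; apply/negP; rewrite -leNgt.
have -> : g (u K).1 - g (u K).2 = (g a - g (u K).2) - (g a - g (u K).1) by lra.
by apply: (le_trans (ler_normB _ _)); lra.
Qed.

End sequence_space.

(** * Integral estimates *)

(** Adding [e] makes the differences [b u - a u] nonnegative, and as the sums agree their total is
    [e * #|U|]. Removing the added [e] costs the same amount again. *)
Lemma sum_weights_close (R : realFieldType) (U : finType) (h a b : U -> R)
    (M e : R) : (forall u, `|h u| <= M) -> (forall u, a u - e <= b u) ->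
  \sum_u a u = \sum_u b u ->
  `|\sum_u h u * b u - \sum_u h u * a u| <= 2 * M * e * #|U|%:R.
Proof.
move=> hM ab sab.
have -> : \sum_u h u * b u - \sum_u h u * a u =
    \sum_u h u * (b u - a u + e) - \sum_u h u * e.
  by rewrite -!sumrB; apply: eq_bigr => u _; ring.
have be u : 0 <= b u - a u + e by have := ab u; lra.
have s1 : `|\sum_u h u * (b u - a u + e)| <= \sum_u M * (b u - a u + e).
  apply: le_trans (ler_norm_sum _ _ _) _; apply: ler_sum => u _.
  by rewrite normrM (ger0_norm (be u)) ler_wpM2r.
have s2 : `|\sum_u h u * e| <= \sum_(u : U) M * `|e|.
  apply: le_trans (ler_norm_sum _ _ _) _; apply: ler_sum => u _.
  by rewrite normrM ler_wpM2r.
(* A negative [e] would force [a < b] everywhere, against the equality of the sums, as soon as [U]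
   is inhabited. *)
have e0 (u : U) : 0 <= e.
  rewrite leNgt; apply/negP => e0.
  suff : \sum_u a u < \sum_u b u by rewrite sab ltxx.
  apply: ltr_sum; first by apply/hasP; exists u; rewrite ?mem_index_enum.
  by move=> v _; have := ab v; lra.
apply: le_trans (ler_normB _ _) _; apply: le_trans (lerD s1 s2) _.
have sc (x : R) : \sum_(u : U) x = x * #|U|%:R by rewrite sumr_const mulr_natr.
rewrite -mulr_sumr big_split/= sumrB sab subrr add0r !sc.
case: (pickP (fun _ : U => true)) => [u _|no].
  by rewrite (ger0_norm (e0 u)); move: (#|U|%:R) => N; clear; lra.
by rewrite (_ : #|U| = 0%N) ?mulr0 ?addr0//; exact: eq_card0.
Qed.

Section bounded_integrals.
Context {d : measure_display} {X : measurableType d} {R : realType}.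
Variables (mu : probability X R) (D : set X).
Hypothesis mD : measurable D.

Lemma bounded_integrable (f : X -> R) (M : R) : measurable_fun setT f ->
  (forall x, `|f x| <= M) -> mu.-integrable D (EFin \o f).
Proof.
move=> mf fM; apply: measurable_bounded_integrable => //.
- exact: probability_ltey.
- exact: measurable_funS mf.
- by exists M; split; rewrite ?num_real// => r Mr x _; exact: le_trans (fM x) (ltW Mr).
Qed.

Lemma Rintegral_close (f f' : X -> R) (e : R) :
  mu.-integrable D (EFin \o f) -> mu.-integrable D (EFin \o f') ->
  (forall x, D x -> `|f x - f' x| <= e) ->
  `|\int[mu]_(x in D) f x - \int[mu]_(x in D) f' x| <= e * fine (mu D).
Proof.
move=> mf mf' ff'; rewrite -RintegralB// -Rintegral_cst//.
have iB : mu.-integrable D (EFin \o (f \- f')).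
  by rewrite (_ : _ \o _ = (EFin \o f) \- (EFin \o f'))%E//; exact: integrableB.
apply: le_trans (le_normr_Rintegral _ iB) _ => //.
apply: le_Rintegral => //.
- by have := integrable_abse iB.
- apply: (@bounded_integrable (cst e) `|e|) => //; exact: measurable_cst.
Qed.

Lemma measurable_fun_finite_valued (U : finType) (W : X -> U) (h : U -> R) :
  (forall u, measurable (W @^-1` [set u])) -> measurable_fun setT (h \o W).
Proof.
move=> mW _ B mB; rewrite setTI comp_preimage.
exact: measurable_finite_valued.
Qed.

Lemma Rintegral_finite_valued (U : finType) (W : X -> U) (h : U -> R) :
  (forall u, measurable (W @^-1` [set u])) ->
  \int[mu]_(x in D) h (W x) =
  \sum_u h u * fine (mu (D `&` W @^-1` [set u])).
Proof.
move=> mW.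
have hE x : (h (W x))%:E = (\sum_u (h u)%:E * (\1_(W @^-1` [set u]) x)%:E)%E.
  rewrite (bigD1 (W x))//= indicE mem_set// mule1 big1 ?adde0// => u ne.
  rewrite indicE memNset ?mule0//= => eq; by rewrite eq eqxx in ne.
have i1 u : mu.-integrable D (fun x => (\1_(W @^-1` [set u]) x)%:E).
  apply: (integrableS measurableT) => //.
  by apply: integrable_indic.
rewrite /Rintegral (eq_integral (fun x => \sum_u (h u)%:E * (\1_(W @^-1` [set u]) x)%:E)%E).
  rewrite integral_sum//; last by move=> u; exact: integrableZl.
  rewrite (eq_bigr (fun u => (h u * fine (mu (D `&` W @^-1` [set u])))%:E)).
    by rewrite sumEFin.
  move=> u _; rewrite integralZl// integral_indic// EFinM fineK_measure 1?setIC//.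
  exact: measurableI.
by move=> x _; rewrite hE.
Qed.

End bounded_integrals.

(** * From words back to sequences; shifts of a stationary process *)

Section extension.
Context {R : realType} {F : metricType R}.

Definition extend (J : Type) (pt : J -> F) (c : F) k (v : {ffun 'I_k -> J}) :
    nat -> F :=
  fun n => oapp (fun i => pt (v i)) c (insub n).

Lemma extendE (J : Type) (pt : J -> F) c k (z : nat -> J) n : (n < k)%N ->
  extend pt c [ffun i : 'I_k => z i] n = pt (z n).
Proof. by move=> nk; rewrite /extend insubT/= ffunE. Qed.

Variable q : nat -> @quantizer R F.
Hypothesis qP : forall l, quantizer_spec l.+1%:R^-1 (q l).

(** The stage [l] governs both the word length and the mesh: once [l > n], coordinate [n] is the
    quantized value, within [1 / l.+1] of [z n]. *)
Lemma extend_quantized_cvg (c : F) (z : nat -> F) n :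
  extend (@q_point _ _ (q l)) c [ffun i : 'I_l => q_label (q l) (z i)] n
    @[l --> \oo] --> z n.
Proof.
apply/cvg_ballP => e e0; near=> l.
rewrite (extendE _ _ (fun i => q_label (q l) (z i))); last by near: l; exact: nbhs_infty_gt.
apply: (@le_ball _ _ _ l.+1%:R^-1); last exact: (proj2 (qP l)).
by apply: ltW; near: l; exact: (near_infty_natSinv_lt (PosNum e0)).
Unshelve. all: by end_near. Qed.

Lemma measurable_label {d} {Om : measurableType d} (Y : Om -> F) l a :
  borel_measurable_fun setT Y ->
  measurable ((q_label (q l) \o Y) @^-1` [set a]).
Proof.
by move=> [_ mY]; have := mY _ (proj1 (qP l) a); rewrite setTI.
Qed.

(** By continuity the function is a pointwise limit of functions of finitely many quantized
    coordinates, so no sigma-algebra on the sequence space is required. *)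
Lemma measurable_continuous_process {d} {Om : measurableType d}
    (Y : nat -> Om -> F) (g : {ptws nat -> F} -> R) :
  continuous g -> (forall n, borel_measurable_fun setT (Y n)) ->
  measurable_fun setT (fun w => g (fun n => Y n w)).
Proof.
move=> cg mY.
pose c := Y 0 point.
pose Z l n w := q_label (q l) (Y n w).
apply: (@measurable_realfun.measurable_fun_cvg _ _ _ _
  (fun l => (fun v => g (extend (@q_point _ _ (q l)) c v)) \o @word _ _ _ (Z l) l)).
  move=> l; apply: measurable_fun_finite_valued => v; apply: measurable_word.
  by move=> n a; exact: measurable_label.
move=> w _.
exact: (@continuous_pointwise_cvg _ _ _ cg _ _
  (@extend_quantized_cvg c (fun n => Y n w))).
Qed.

End extension.

Lemma stationary_shift {d} {Om : measurableType d} {R : realType}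
    {F : topologicalType} (P : probability Om R) (Y : nat -> Om -> F)
    s k (B : nat -> set F) :
  stationary P Y -> (forall i, borel_set (B i)) ->
  P [set w | forall i, (i < k)%N -> B i (Y (s + i)%N w)] =
  P [set w | forall i, (i < k)%N -> B i (Y i w)].
Proof.
move=> [_ st] mB; elim: s => // s <-.
(* Padding with [s] trivial conditions turns the step from shift [s] to shift [s.+1] into a shift by
   one of longer cylinders. *)
pose B' i := if (i < s)%N then setT else B (i - s)%N.
have mB' i : borel_set (B' i).
  rewrite /B'; case: ifP => // _; apply: sub_gen_smallest; exact: openT.
have eqs m : [set w | forall i, (i < k)%N -> B i (Y (m + (s + i))%N w)] =
    [set w | forall i, (i < s + k)%N -> B' i (Y (m + i)%N w)].
  apply/seteqP; split=> w H i ik.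
    rewrite /B'; case: ltnP => // si; rewrite -{2}(subnKC si).
    by apply: H; rewrite ltn_subLR.
  have := H (s + i)%N; rewrite /B' ltn_add2l ik ltnNge leq_addr addKn.
  exact.
have := st (s + k)%N B' mB'.
by rewrite -(eqs 0%N) -(eqs 1%N).
Qed.

Lemma stationary_cylinder {d} {Om : measurableType d} {R : realType}
    {F : topologicalType} (P : probability Om R) (Y : nat -> Om -> F)
    (J : finType) (lab : F -> J) :
  stationary P Y -> (forall j, borel_set (lab @^-1` [set j])) ->
  forall s k (v : {ffun 'I_k -> J}),
    P (cylinder (fun n w => lab (Y n w)) s v) =
    P (cylinder (fun n w => lab (Y n w)) 0 v).
Proof.
move=> st mlab s k v.
pose B i := oapp (fun t : 'I_k => lab @^-1` [set v t]) setT (insub i).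
have mB i : borel_set (B i).
  rewrite /B; case: insubP => //= _; apply: sub_gen_smallest; exact: openT.
have eqs m : cylinder (fun n w => lab (Y n w)) m v =
    [set w | forall i, (i < k)%N -> B i (Y (m + i)%N w)].
  apply/seteqP; split=> w H.
    by move=> i ik; rewrite /B insubT/=; exact: (H (Ordinal ik)).
  by move=> t; have := H t (ltn_ord t); rewrite /B valK.
by rewrite !eqs; exact: stationary_shift.
Qed.

Section return_process_close.
Context {R : realType} {d : measure_display} {X : measurableType d}.
Context {F : metricType R}.
Variables (mu : probability X R) (D : set X) (S : X -> X).
Hypotheses (mD : measurable D) (mS : forall n B, measurable B ->
  measurable (iter n S @^-1` B)).
Variables (J : finType) (pt : J -> F) (c : F) (psi : X -> J) (k : nat).
Hypothesis mpsi : forall a, measurable (psi @^-1` [set a]).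
Variables (g : {ptws nat -> F} -> R) (M eta e : R) (p : {ffun 'I_k -> J} -> R).

(** Replacing a sequence by its padded prefix of length [k] costs [eta]. The integral is then a
    finite sum over words, to which [sum_weights_close] applies. *)
Lemma return_process_close :
  measurable_fun setT (fun x => g (fun n => pt (psi (iter n S x)))) ->
  (forall z, `|g z| <= M) ->
  (forall z z' : nat -> F, (forall n, (n < k)%N -> z n = z' n) ->
    `|g z - g z'| <= eta) ->
  \sum_v p v = 1 ->
  (forall v, fine (mu D) * p v - e <= fine (mu (label_cylinder S psi v `&` D))) ->
  `|\int[mu]_(x in D) g (fun n => pt (psi (iter n S x))) -
    fine (mu D) * \sum_v g (extend pt c v) * p v| <=
  eta * fine (mu D) + 2 * M * e * #|{ffun 'I_k -> J}|%:R.
Proof.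
move=> mg gM geta p1 pe.
pose Z n x := psi (iter n S x).
have mZ n a : measurable (Z n @^-1` [set a]) by exact: (mS n (mpsi a)).
pose W := @word _ _ _ Z k.
have mW v : measurable (W @^-1` [set v]) by exact: measurable_word.
pose h (v : {ffun 'I_k -> J}) := g (extend pt c v).
have iW : mu.-integrable D (EFin \o (h \o W)).
  apply: (@bounded_integrable _ _ _ mu _ mD _ M) => [|x]; last exact: gM.
  exact: measurable_fun_finite_valued.
have ig : mu.-integrable D (EFin \o (fun x => g (fun n => pt (psi (iter n S x))))).
  exact: (@bounded_integrable _ _ _ _ _ _ _ M).
have cl := Rintegral_close mD ig iW.
have {}cl : `|\int[mu]_(x in D) g (fun n => pt (psi (iter n S x))) -
    \int[mu]_(x in D) h (W x)| <= eta * fine (mu D).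
  apply: cl => x _; apply: geta => n nk.
  by rewrite (extendE _ _ (fun i => psi (iter i S x))).
have EW := Rintegral_finite_valued mu mD h mW.
have := @sum_weights_close R _ h (fun v => fine (mu D) * p v)
  (fun v => fine (mu (D `&` W @^-1` [set v]))) M e.
rewrite -EW.
have -> : \sum_v h v * (fine (mu D) * p v) = fine (mu D) * \sum_v h v * p v.
  by rewrite mulr_sumr; apply: eq_bigr => v _; rewrite mulrCA.
move=> cw.
rewrite -[X in `|X|](subrKA (\int[mu]_(x in D) h (W x))).
apply: (le_trans (ler_normD _ _)); apply: lerD => //; apply: cw => [v|v|].
- exact: gM.
- by rewrite setIC preimage_word; exact: pe.
rewrite -mulr_sumr p1 mulr1.
have := @fine_measure_finite_valued _ _ _ mu _ W xpredT D mD mW.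
by rewrite (_ : [set x | xpredT (W x)] = setT) ?setIT//; apply/seteqP; split.
Qed.

End return_process_close.

(** * Choice of the observables and convergence of the integrals *)

Theorem mainTheorem4 (R : realType) (d : measure_display) (X : measurableType d)
  (mu : probability X R) (T : X -> X) (A : nat -> set X)
  (F : metricType R) (d' : measure_display) (Om : measurableType d')
  (P : probability Om R) (Y : nat -> Om -> F) :
  measure_preserving mu T -> ergodic mu T -> nonatomic mu ->
  asymptotically_rare mu A ->
  compact [set: F] ->
  stationary P Y ->
  exists psi : nat -> X -> F,
    (forall l, borel_measurable_fun (A l) (psi l)) /\
    (* weak convergence of the law of Psi_{A_l} under mu_{A_l} to the law of Y,
       on F^N with the product topology *)
    forall g : {ptws nat -> F} -> R, continuous g ->
      (exists M : R, forall z, `|g z| <= M) ->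
      (fun l => ((fine (mu (A l)))^-1)%:E *
                \int[mu]_(x in A l) (g (Psi_proc T (A l) (psi l) x))%:E)%E
        @ \oo --> (\int[P]_w (g (fun n => Y n w))%:E)%E.
Proof.
move=> pT eT na [Apos _] cF stY; have [mY _] := stY.
have mA l : measurable (A l) by case: (Apos l).
have A0 l : (0 < mu (A l))%E by case: (Apos l).
have a0 l : 0 < fine (mu (A l)).
  by have := A0 l; rewrite -(fineK_measure mu (mA l)) lte_fin.
pose c := Y 0 point.
have q_ex l : exists q : @quantizer R F, quantizer_spec l.+1%:R^-1 q.
  by apply: (quantizer_exists c cF); rewrite invr_gt0 ltr0n.
have [q qP] := choice q_ex.
pose Z l n w := q_label (q l) (Y n w).
have mZ l n a : measurable (Z l n @^-1` [set a]).
  exact: (measurable_label qP a (mY n)).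
pose S l := first_return_map T (A l).
(* Dividing by the number of words absorbs the sum over words; after normalization by [mu (A l)] an
   error [2 * M / l.+1] remains. *)
pose e l := fine (mu (A l)) / (l.+1%:R * #|{ffun 'I_l -> q_type (q l)}|%:R).
have card0 l : 0 < #|{ffun 'I_l -> q_type (q l)}|%:R :> R.
  by rewrite ltr0n; apply/card_gt0P; exists [ffun=> Z l 0%N point].
(* The finite-valued [psj] has a type depending on [l], so it stays under the existential and
   [choice] is applied to [psi] only. *)
have psi_ex l : exists psi : X -> F,
    exists psj : X -> q_type (q l), [/\ psi = @q_point _ _ (q l) \o psj,
      forall a, measurable (psj @^-1` [set a]) &
      forall v : {ffun 'I_l -> _},
        fine (mu (A l)) * fine (P (cylinder (Z l) 0 v)) - e l <=
        fine (mu (label_cylinder (S l) psj v `&` A l))].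
  have [|||||psj [mpsj H]] := @process_approximation _ _ _ _ _
    (restr_probability mu (mA l)) (S l) P _ (Z l) (mZ l) _ _ _ _ l (e l).
  - exact: (stationary_cylinder stY (proj1 (qP l))).
  - exact: (first_return_map_preserving pT eT).
  - exact: first_return_map_nonatomic.
  - exact: (first_return_map_hit pT eT).
  - by rewrite divr_gt0// mulr_gt0// ltr0n.
  exists (@q_point _ _ (q l) \o psj), psj; split=> // v.
  by have := H v; rewrite !restr_probabilityE setTI.
have [psi psiP] := choice psi_ex.
exists psi; split.
  move=> l; have [psj [-> mpsj _]] := psiP l; split=> // B _.
  apply: measurableI => //; rewrite comp_preimage.
  exact: measurable_finite_valued.
move=> g cg [M gM].
have M0 : 0 <= M by exact: le_trans (gM (fun=> c)).
pose h l (v : {ffun 'I_l -> q_type (q l)}) := g (extend (@q_point _ _ (q l)) c v).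
(* The expectation of [g] at the quantized and truncated target links the two sides: it converges to
   the limit by dominated convergence and is close to the return averages by [est]. *)
pose J l := \sum_v h l v * fine (P (cylinder (Z l) 0 v)).
have mgY : measurable_fun setT (fun w => g (fun n => Y n w)).
  exact: (measurable_continuous_process qP).
have igY : P.-integrable setT (EFin \o (fun w => g (fun n => Y n w))).
  by apply: (@bounded_integrable _ _ _ P _ measurableT _ M).
have JE l : \int[P]_w h l (@word _ _ _ (Z l) l w) = J l.
  rewrite Rintegral_finite_valued//; last exact: measurable_word.
  by apply: eq_bigr => v _; rewrite setTI preimage_word.
have Jcvg : J l @[l --> \oo] --> \int[P]_w g (fun n => Y n w).
  have [|||||_ _ H] := @dominated_convergence _ _ _ P setT measurableT
    (fun l w => (h l (@word _ _ _ (Z l) l w))%:E)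
    (fun w => (g (fun n => Y n w))%:E) (cst M%:E).
  - move=> l; apply/measurable_realfun.measurable_EFinP.
    by apply: measurable_fun_finite_valued => v; exact: measurable_word.
  - exact/measurable_realfun.measurable_EFinP.
  - apply: aeW => w _; apply: cvg_EFin; first exact: nearW.
    exact: (@continuous_pointwise_cvg _ _ _ cg _ _
      (@extend_quantized_cvg _ _ _ qP c (fun n => Y n w))).
  - by apply: (@bounded_integrable _ _ _ P _ measurableT (cst M) `|M|).
  - by apply: aeW => w l _; rewrite lee_fin; exact: gM.
  have := H; rewrite -(fineK (integrable_fin_num measurableT igY)) => /fine_cvg.
  by apply: cvg_trans; apply: near_eq_cvg; apply: nearW => l; rewrite /= -JE.
have mgPsi l : measurable_fun setT (fun x => g (Psi_proc T (A l) (psi l) x)).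
  have [psj [psiE mpsj H]] := psiP l.
  have pS := first_return_map_preserving pT eT (mA l) (A0 l).
  apply: (@measurable_continuous_process _ _ _ qP _ _
    (fun n x => psi l (iter n (S l) x))) => // n.
  split=> // B _; rewrite setTI psiE.
  apply: (measurable_iter_preimage pS n (B := (@q_point _ _ (q l) \o psj) @^-1` B)).
  rewrite comp_preimage; exact: measurable_finite_valued.
have igPsi l : mu.-integrable (A l)
    (EFin \o (fun x => g (Psi_proc T (A l) (psi l) x))).
  by apply: (@bounded_integrable _ _ _ mu _ (mA l) _ M) => // x; exact: gM.
have est eta K : (forall z z' : nat -> F, (forall n, (n < K)%N -> z n = z' n) ->
    `|g z - g z'| <= eta) -> forall l, (K <= l)%N ->
    `|(fine (mu (A l)))^-1 * \int[mu]_(x in A l) g (Psi_proc T (A l) (psi l) x)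
      - J l| <= eta + 2 * M / l.+1%:R.
  move=> gK l Kl; have [psj [psiE mpsj H]] := psiP l.
  have pS := first_return_map_preserving pT eT (mA l) (A0 l).
  have := @return_process_close R _ _ F mu (A l) (S l) (mA l)
    (fun n B => measurable_iter_preimage pS n (B := B)) _ (@q_point _ _ (q l)) c psj l mpsj
    g M eta (e l) (fun v => fine (P (cylinder (Z l) 0 v))).
  have -> : 2 * M * e l * #|{ffun 'I_l -> q_type (q l)}|%:R =
      2 * M / l.+1%:R * fine (mu (A l)).
    by rewrite /e; field; rewrite !gt_eqF.
  rewrite (sum_cylinder P (mZ l)) -/(J l).
  have -> : (fun x => g (fun n => q_point (psj (iter n (S l) x)))) =
      (fun x => g (Psi_proc T (A l) (psi l) x)).
    by rewrite psiE.
  move=> /(_ (mgPsi l) gM _ erefl H) close.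
  rewrite -(ler_pM2r (a0 l)) mulrDl -(gtr0_norm (a0 l)) -normrM (gtr0_norm (a0 l)).
  rewrite mulrBl mulrAC mulVf ?gt_eqF// mul1r [J l * _]mulrC.
  apply: close => z z' zz'; apply: gK => n nK; apply: zz'; exact: leq_trans nK Kl.
rewrite -(fineK (integrable_fin_num measurableT igY)).
rewrite (_ : (fun l => _) = (fun l => ((fine (mu (A l)))^-1 *
    \int[mu]_(x in A l) g (Psi_proc T (A l) (psi l) x))%:E)); last first.
  apply/funext => l; rewrite EFinM; congr (_ * _)%E.
  by rewrite fineK// (integrable_fin_num (mA l) (igPsi l)).
apply: cvg_EFin; first exact: nearW.
apply/cvgrPdist_le => eps eps0.
(* One third of [eps] for cutting to prefixes, one for the word frequencies, one for the convergence
   of [J]. *)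
have [|K gK] := continuous_prefix cg cF (e := eps / 3); first lra.
near=> l.
have Kl : (K <= l)%N by near: l; exact: nbhs_infty_ge.
have h1 := est _ _ gK l Kl.
have h2 : `|\int[P]_w g (fun n => Y n w) - J l| <= eps / 3.
  by near: l; move/cvgrPdist_le : Jcvg; apply; lra.
have h3 : 2 * M / l.+1%:R <= eps / 3.
  have lM : 6 * M / eps <= l.+1%:R.
    near: l; have := nbhs_infty_ger (6 * M / eps); apply: filterS => n.
    by move=> le; rewrite (le_trans le)// ler_nat.
  rewrite ler_pdivrMr ?ltr0n//; rewrite ler_pdivrMr// in lM; lra.
rewrite distrC in h1; apply: (le_trans (ler_distD (J l) _ _)) => /=.
apply: (le_trans (lerD h2 h1)).
by move: h3; move: (2 * M / _) => r h3; lra.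
Unshelve. all: by end_near. Qed.
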